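(* Let $G$ be a finitely generated group, let $\varphi:G\times X\to X$ be a continuous action on a compact metric space $(X,d)$, and let $\mu\in\mathcal{M}_{PSh}(X,\varphi)$. Then $\varphi$ has the persistent shadowing property on $supp(\mu)$.
   Context: Fix a finite generating set $S$ of $G$ (discrete topology). For continuous actions $\varphi,\psi$ of $G$ on $X$ put $d_S(\varphi,\psi)=\sup\{d(\varphi(s,x),\psi(s,x)): x\in X, s\in S\}$. A map $f:G\to X$ is a $\delta$-pseudo orbit for $\psi$ if $d(f(sg),\psi(s,f(g)))<\delta$ for all $s\in S$, $g\in G$; it is $(\psi,\epsilon)$-shadowed by $p\in X$ if $d(f(g),\psi(g,p))<\epsilon$ for all $g\in G$. $Sh_\psi(\delta,\epsilon)$ is the set of $x\in X$ such that every $\delta$-pseudo orbit $f$ for $\psi$ with $f(e)=x$ is $(\psi,\epsilon)$-shadowed by a point of $X$. $\mathcal{M}(X)$ is the set of Borel probability measures on $X$. $\mathcal{M}_{PSh}(X,\varphi)$ (measures compatible with the persistent shadowing property for $\varphi$) is the set of $\mu\in\mathcal{M}(X)$ such that for every $\epsilon>0$ there is $\delta>0$ such that for every Borel set $A\subseteq X$ with $\mu(A)>0$ one has $A\cap Sh_\psi(\delta,\epsilon)\neq\emptyset$ for every continuous action $\psi:G\times X\to X$ with $d_S(\varphi,\psi)<\delta$. $\varphi$ has the persistent shadowing property on a set $K\subseteq X$ if for every $\epsilon>0$ there is $\delta>0$ such that for every continuous action $\psi:G\times X\to X$ with $d_S(\varphi,\psi)<\delta$, every $\delta$-pseudo orbit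 $f:G\to X$ for $\psi$ with $f(e)\in K$ is $(\psi,\epsilon)$-shadowed by a point of $X$. *)

(* Defs.v *)
From HB Require Import structures.
From mathcomp Require Import all_boot all_order all_algebra.
From mathcomp Require Import all_classical all_reals all_analysis.

Set Implicit Arguments.
Unset Strict Implicit.
Unset Printing Implicit Defensive.

Import Order.TTheory GRing.Theory Num.Theory.

Local Open Scope classical_set_scope.
Local Open Scope ring_scope.

(* [measurableType], hence [probability], requires a pointed carrier; this
   only excludes the empty space, which carries no probability measure. *)
#[short(type="pmetricType")]
HB.structure Definition PointedMetric (R : numDomainType) :=
  {X of Metric R X & Pointed X}.

Definition borelType (X : ptopologicalType) := g_sigma_algebraType (@open X).

Definition measure_support (R : realType) (X : pmetricType R)
    (mu : probability (borelType X) R) : set X :=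
  [set x | forall U : set X, open U -> U x -> (0 < mu U)%E].

Definition finite_generating_set (G : groupType) (S : set G) : Prop :=
  finite_set S /\
  forall H : {pred G}, group_closed H -> {subset S <= H} ->
    forall g : G, g \in H.

Section Shadowing.
Context (R : realType) (G : groupType) (X : pmetricType R).
Implicit Types (S : set G) (phi psi : G * X -> X) (f : G -> X).
Implicit Types (K : set X) (delta eps : R).

Definition continuous_action phi : Prop :=
  [/\ forall x, phi (1%g, x) = x,
      forall g h x, phi ((g * h)%g, x) = phi (g, phi (h, x)) &
      continuous (phi : discrete_topology G * X -> X)].

(* On a compact [X] with [S] finite this set is bounded; when it is empty
   its [sup] is [0]. *)
Definition action_dist S phi psi : R :=
  sup [set mdist (phi (s, x)) (psi (s, x)) | s in S & x in [set: X]].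

Definition pseudo_orbit S psi delta f : Prop :=
  forall s g, S s -> mdist (f (s * g)%g) (psi (s, f g)) < delta.

Definition shadowed psi eps f (p : X) : Prop :=
  forall g, mdist (f g) (psi (g, p)) < eps.

Definition Sh S psi delta eps : set X :=
  [set x | forall f, pseudo_orbit S psi delta f -> f 1%g = x ->
             exists p, shadowed psi eps f p].

Definition M_PSh S phi : set (probability (borelType X) R) :=
  [set mu | forall eps, 0 < eps -> exists2 delta, 0 < delta &
    forall A : set (borelType X), measurable A -> (0 < mu A)%E ->
    forall psi, continuous_action psi -> action_dist S phi psi < delta ->
      A `&` Sh S psi delta eps !=set0].

Definition persistent_shadowing_on S phi K : Prop :=
  forall eps, 0 < eps -> exists2 delta, 0 < delta &
    forall psi, continuous_action psi -> action_dist S phi psi < delta ->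
    forall f, pseudo_orbit S psi delta f -> K (f 1%g) ->
      exists p, shadowed psi eps f p.

End Shadowing.

(* Main.v *)
Require Import Defs.
From mathcomp Require Import all_boot all_order all_algebra.
From mathcomp Require Import all_classical all_reals all_analysis.
From mathcomp Require Import lra.

Set Implicit Arguments.
Unset Strict Implicit.
Unset Printing Implicit Defensive.

Import Order.TTheory GRing.Theory Num.Theory.

Local Open Scope classical_set_scope.
Local Open Scope ring_scope.

(** The support of [mu] consists of the points all of whose neighborhoods have
    positive measure, so compatibility of [mu] only provides points of
    [Sh S psi delta eps] arbitrarily close to a given [x] in the support, not
    [x] itself.  This is enough because shadowing is insensitive to a small
    displacement of the base point: if a pseudo orbit [f] through [x] is
    modified at the identity only, by moving [x] to a nearby point [y], then
    the defect of [f] grows by at most the distance from [x] to [y] plus the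
    largest distance from [psi (s, x)] to [psi (s, y)], [s] in [S].  As [S] is
    finite and each [psi (s, _)] is continuous, both terms are small for [y] in
    a neighborhood of [x].  A point shadowing the modified pseudo orbit also
    shadows [f], up to the distance from [x] to [y].

    The neighborhood depends on [psi], whereas [delta] must not.  This is
    harmless: compatibility selects [delta] before the set of positive measure,
    so half of the [delta] given by compatibility for [eps / 2] works
    for every [psi]. *)

Lemma near_finite (I : choiceType) (S : set I) (T : Type) (F : set_system T)
    (P : I -> T -> Prop) : Filter F -> finite_set S ->
  (forall i, S i -> \forall t \near F, P i t) ->
  \forall t \near F, forall i, S i -> P i t.
Proof.
move=> FF /finite_fsetP[A ->] FP.
exact: (@filter_bigI _ _ A (fun i => [set t | P i t])).
Qed.

Lemma continuous_action_fiber (R : realType) (G : groupType) (X : pmetricType R)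
    (psi : G * X -> X) (g : G) :
  continuous_action psi -> continuous (fun x => psi (g, x)).
Proof.
move=> [_ _ psi_cont] x.
have incl : (g : discrete_topology G, y) @[y --> x] --> (g : discrete_topology G, x).
  apply: (@cvg_pair _ _ _ (nbhs x) (nbhs (g : discrete_topology G)) (nbhs x)).
  - exact: cvg_cst.
  - exact: cvg_id.
exact: cvg_comp incl (psi_cont (g, x)).
Qed.

(** A neighborhood need not be Borel; its interior is, and still contains the
    point of the support. *)
Lemma measure_support_near (R : realType) (X : pmetricType R)
    (mu : probability (borelType X) R) (x : X) (P : set X) :
  measure_support mu x -> (\forall y \near x, P y) ->
  exists A : set (borelType X),
    [/\ measurable A, (0 < mu A)%E & A `<=` P].
Proof.
move=> mux /nbhs_interior xP; exists P°; split; last exact: interior_subset.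
- by apply: sub_sigma_algebra; exact: open_interior.
- by apply: mux; [exact: open_interior | exact: nbhs_singleton].
Qed.

Definition move_base (G : groupType) (X : Type) (f : G -> X) (y : X) : G -> X :=
  fun g => if g == 1%g then y else f g.

Section MoveBase.
Context (R : realType) (G : groupType) (X : pmetricType R).
Variables (S : set G) (psi : G * X -> X) (f : G -> X) (y : X) (r : R).
Hypothesis near_base : mdist (f 1%g) y < r.

Lemma mdist_move_base g : mdist (f g) (move_base f y g) < r.
Proof.
rewrite /move_base; case: eqP => [->//|_]; rewrite mdistxx.
by apply: le_lt_trans near_base; exact: mdist_ge0.
Qed.

(** The displaced point occurs on both sides of the pseudo orbit inequality, as
    [f (s * g)] and as [f g]; each occurrence costs at most [r]. *)
Lemma pseudo_orbit_move_base delta :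
  (forall s, S s -> mdist (psi (s, f 1%g)) (psi (s, y)) < r) ->
  pseudo_orbit S psi delta f ->
  pseudo_orbit S psi (delta + r + r) (move_base f y).
Proof.
move=> near_img fP s g Ss; have sg := mdist_move_base (s * g)%g.
have img : mdist (psi (s, f g)) (psi (s, move_base f y g)) < r.
  rewrite /move_base; case: eqP => [->|_]; first exact: near_img.
  rewrite mdistxx; apply: le_lt_trans near_base; exact: mdist_ge0.
have fsg := fP s g Ss.
have t1 := metric_triangle (move_base f y (s * g)%g) (f (s * g)%g)
             (psi (s, move_base f y g)).
have t2 := metric_triangle (f (s * g)%g) (psi (s, f g))
             (psi (s, move_base f y g)).
rewrite metric_sym in sg; lra.
Qed.

Lemma shadowed_move_base eps p :
  shadowed psi eps (move_base f y) p -> shadowed psi (r + eps) f p.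
Proof.
move=> sh g; apply: le_lt_trans (metric_triangle _ (move_base f y g) _) _.
by apply: ltrD; [exact: mdist_move_base | exact: sh].
Qed.

End MoveBase.

Theorem proposition2p11 (R : realType) (G : groupType) (S : set G)
    (X : pmetricType R) (phi : G * X -> X)
    (mu : probability (borelType X) R) :
  finite_generating_set S ->
  compact [set: X] ->
  continuous_action phi ->
  M_PSh S phi mu ->
  persistent_shadowing_on S phi (measure_support mu).
Proof.
move=> [finS _] _ _ muP eps eps0.
have [|delta delta0 deltaP] := muP (eps / 2); first by rewrite divr_gt0.
exists (delta / 2); first by rewrite divr_gt0.
move=> psi psi_act psi_close f f_orbit f_supp.
(* The displacement enters the defect twice, where delta / 2 is left for it,
   and the shadowing error once, where eps / 2 is left. *)
pose r := Num.min (delta / 4) (eps / 2).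
have r0 : 0 < r by rewrite lt_min !divr_gt0.
have [r_delta r_eps] : r <= delta / 4 /\ r <= eps / 2.
  by split; rewrite ge_min lexx ?orbT.
have near_f1 : \forall y \near f 1%g, mdist (f 1%g) y < r /\
    forall s, S s -> mdist (psi (s, f 1%g)) (psi (s, y)) < r.
  apply: filterI.
    exact: (metricType_numDomainType.cvgr_dist_lt (f := id) cvg_id r0).
  apply: near_finite => // s _.
  have psi_s : {for f 1%g, continuous (fun y => psi (s, y))}.
    exact: continuous_action_fiber.
  exact: (metricType_numDomainType.cvgr_dist_lt psi_s r0).
have [A [mA A_pos subA]] := measure_support_near f_supp near_f1.
have [|y [/subA[y_near psi_y_near] Sh_y]] := deltaP A mA A_pos psi psi_act.
  by apply: lt_trans psi_close _; lra.
have orbit_y : pseudo_orbit S psi delta (move_base f y).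
  move=> s g Ss.
  have := pseudo_orbit_move_base y_near psi_y_near f_orbit g Ss; lra.
have [|p p_shadows] := Sh_y _ orbit_y; first by rewrite /move_base eqxx.
exists p => g.
have := shadowed_move_base y_near p_shadows g; lra.
Qed.
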